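(* Let $n\ge 3$, $0\le m<\frac{n-2}{n}$, $\rho_1>0$, $\lambda>0$, $\beta>\beta_0^{(m)}:=\frac{m\rho_1}{n-2-nm}$ and $\alpha_m=\frac{2\beta+\rho_1}{1-m}$. Let $v_1,v_2$ be radially symmetric solutions of $$\Delta\phi_m(v)+\alpha_m v+\beta x\cdot\nabla v=0,\quad v>0,\quad\text{in }\mathbb{R}^n\setminus\{0\}$$ both of which satisfy $$\lim_{|x|\to 0}|x|^{\alpha_m/\beta}v(x)=\lambda^{-\frac{\rho_1}{(1-m)\beta}}.$$ Then $v_1(r)=v_2(r)$ for all $r>0$.
   Context: $\phi_m(u)=u^m/m$ if $m\ne0$ and $\phi_0(u)=\log u$. A solution of the elliptic equation in $\mathbb{R}^n\setminus\{0\}$ is a positive function $v\in C^2(\mathbb{R}^n\setminus\{0\})$ satisfying the equation in the classical sense. A radially symmetric $v$ is also written as a function $v(r)$ of $r=|x|$. *)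

(* Defs.v *)
From mathcomp Require Import all_boot all_order all_algebra.
From mathcomp Require Import all_classical all_reals all_analysis.
Set Implicit Arguments.
Unset Strict Implicit.
Unset Printing Implicit Defensive.
Import Order.TTheory GRing.Theory Num.Theory.
Import numFieldNormedType.Exports.
Local Open Scope classical_set_scope.
Local Open Scope ring_scope.

(* The library norm on 'rV[R]_n is the sup norm; this is the Euclidean one. *)
Definition enorm (R : realType) (n : nat) (x : 'rV[R]_n) : R :=
  Num.sqrt (\sum_(i < n) x ord0 i ^+ 2).

Definition partial (R : realType) (n : nat) (i : 'I_n) (f : 'rV[R]_n -> R) :
  'rV[R]_n -> R := fun x => 'D_(delta_mx ord0 i) f x.

Definition laplacian (R : realType) (n : nat) (f : 'rV[R]_n -> R)
    (x : 'rV[R]_n) : R :=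
  \sum_(i < n) partial i (partial i f) x.

Definition xdotgrad (R : realType) (n : nat) (f : 'rV[R]_n -> R)
    (x : 'rV[R]_n) : R :=
  \sum_(i < n) x ord0 i * partial i f x.

(* C^k on U, where U is meant to be open. *)
Fixpoint Ck_on (R : realType) (n k : nat) (U : set 'rV[R]_n)
    (f : 'rV[R]_n -> R) : Prop :=
  (forall x, U x -> {for x, continuous f}) /\
  match k with
  | 0 => True
  | k'.+1 => forall i : 'I_n,
      (forall x, U x -> derivable f x (delta_mx ord0 i)) /\
      Ck_on k' U (partial i f)
  end.

Definition punctured (R : realType) (n : nat) : set 'rV[R]_n :=
  [set x | x != 0].

Definition phi (R : realType) (m u : R) : R :=
  if m == 0 then ln u else u `^ m / m.

(* v is a total function, but its value at the origin is never used. *)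
Definition elliptic_solution (R : realType) (n : nat) (m alpha beta : R)
    (v : 'rV[R]_n -> R) : Prop :=
  [/\ Ck_on 2 (@punctured R n) v,
      forall x, x != 0 -> 0 < v x &
      forall x, x != 0 ->
        laplacian (fun y => phi m (v y)) x + alpha * v x + beta * xdotgrad v x
          = 0].

(* v is radially symmetric and w is v written as a function of r = |x|. *)
Definition radial_profile (R : realType) (n : nat) (v : 'rV[R]_n -> R)
    (w : R -> R) : Prop :=
  forall x, x != 0 -> v x = w (enorm x).

Definition beta0 (R : realType) (n : nat) (m rho1 : R) : R :=
  m * rho1 / (n%:R - 2 - n%:R * m).

Definition alpham (R : realType) (m beta rho1 : R) : R :=
  (2 * beta + rho1) / (1 - m).

(* Main.v *)
Require Import Defs.
From mathcomp Require Import all_boot all_order all_algebra.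
From mathcomp Require Import all_classical all_reals all_analysis.
From mathcomp Require Import ring lra.
Import Order.TTheory GRing.Theory Num.Theory.
Import numFieldNormedType.Exports.
Local Open Scope classical_set_scope.
Local Open Scope ring_scope.

(** Write [gam := alpha / beta] and [del := rho1 / beta], so that
    [gam (1 - m) = 2 + del] with [del > 0].  On a ray the equation becomes an ODE
    in [r = |x|] for the profiles; let [d := w1 - w2] and
    [f := phi m (w1) - phi m (w2)].  Since [alpha = beta gam],

      [f'' + (n - 1) / r * f' + beta gam d + beta r d' = 0].

    This linear relation becomes a first-order system for
    [g := r^(gam-2) f] and
    [z := r^(gam-1) f' + beta r^gam d + (n - gam) g]:

      [r z' = (n - gam) (gam - 2) g],
      [r g' = z + (2 gam - 2 - n) g - beta r^gam d].

    The choice of [z] removes the derivative of [d].  Both profiles satisfy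
    [w_i >= a r^(-gam)] on (0, S], because [r^gam w_i] is positive with a positive
    limit at 0; as [phi m] is increasing and Lipschitz above [a r^(-gam)] with
    constant [(a r^(-gam))^(m-1)], this gives
    [a^(1-m) g^2 <= r^del * g * (r^gam d)].  The last term of the second equation
    is therefore, after multiplication by [g], a dissipation of at least a constant
    times [r^(-del) g^2]; the factor blows up at 0, and the dissipation
    absorbs the cross terms of the energy [L := z^2 + g^2] up to
    [L' <= C r^(del-1) L] ([quadratic_absorption]).  The weight [r^(del-1)] is
    integrable at 0, so Gronwall's lemma can be started at the singularity: [L]
    vanishes on (0, S] once [L] is arbitrarily small at points arbitrarily close
    to 0 ([singular_gronwall]).

    That smallness is where the common limit enters: [r^gam d] tends to 0, hence
    so does [g] by the inequality above, and the mean value theorem between [x] and [2x]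
    yields points [c] where [c g'(c)], and then [z c], is as small as wanted.  So
    [g = 0], [f = 0] ([singular_ode_uniqueness]) and [w1 = w2] by injectivity of
    [phi m].  No a priori estimate on the derivatives of the solutions is
    needed. *)

(** * Calculus on the positive half-line *)

Lemma is_derive_pos_continuous {R : realType} {f df : R -> R} :
  (forall r : R, 0 < r -> is_derive r 1 f (df r)) ->
  forall a b, 0 < a -> {within `[a, b], continuous f}.
Proof.
move=> Hf a b a0; apply: derivable_within_continuous => x.
rewrite in_itv/= => /andP[ax _].
by have [] := Hf x (lt_le_trans a0 ax).
Qed.

Lemma MVT_pos {R : realType} {f df : R -> R} :
  (forall r : R, 0 < r -> is_derive r 1 f (df r)) ->
  forall a b : R, 0 < a -> a < b ->
  exists2 c : R, a < c < b & f b - f a = df c * (b - a).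
Proof.
move=> Hf a b a0 ab.
have Hab (x : R) : x \in `]a, b[ -> is_derive x 1 f (df x).
  by rewrite in_itv/= => /andP[ax _]; apply: Hf; exact: lt_trans ax.
have [c] := MVT ab Hab (is_derive_pos_continuous Hf _ _ a0).
by rewrite in_itv/= => cab Hc; exists c.
Qed.

Lemma near_right0P {R : realType} (P : R -> Prop) :
  (\forall r \near 0^'+, P r) ->
  exists2 e : R, 0 < e & forall r : R, 0 < r -> r < e -> P r.
Proof.
move=> /nbhs_normP[e /= e0 He]; exists e => // r r0 re; apply: He => //=.
by rewrite sub0r normrN gtr0_norm.
Qed.

Lemma powRB1 {R : realType} (a : R) {r : R} : 0 < r -> r `^ (a - 1) = r `^ a / r.
Proof. by move=> r0; rewrite powRB ?powRr1 ?(ltW r0)// (gt_eqF r0) implybT. Qed.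

Lemma powRB2 {R : realType} (a : R) {r : R} :
  0 < r -> r `^ (a - 2) = r `^ a / r ^+ 2.
Proof.
move=> r0; rewrite powRB; last by rewrite (gt_eqF r0) implybT.
by rewrite (powR_mulrn 2) ?(ltW r0).
Qed.

Lemma is_derive_powRM {R : realType} (a : R) {F : R -> R} {r dF : R} :
  0 < r -> is_derive r 1 F dF ->
  is_derive r 1 (fun s => s `^ a * F s) (r `^ a * dF + a * r `^ a / r * F r).
Proof.
move=> r0 HF; have Hp := is_derive1_powR a r0.
have H := @is_deriveM R R _ _ r 1 _ _ Hp HF.
apply: (is_derive_eq H); rewrite /GRing.scale/= powRB1//.
by field; rewrite gt_eqF.
Qed.

(** * Uniqueness for a singular first-order system *)

(** Gronwall's lemma started at the singular point 0.  The weight [r^(del - 1)] is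
    integrable at 0, so it suffices that [L] has lower limit 0 there; no limit of
    [L] is assumed. *)
Lemma singular_gronwall (R : realType) (L dL : R -> R) (C del S : R) :
  0 < del -> 0 < S ->
  (forall r : R, 0 < r -> is_derive r 1 L (dL r)) ->
  (forall r : R, 0 <= L r) ->
  (forall r : R, 0 < r -> r <= S -> dL r <= C * r `^ (del - 1) * L r) ->
  (forall e rho : R, 0 < e -> 0 < rho -> exists2 x : R, 0 < x < rho & L x <= e) ->
  L S = 0.
Proof.
move=> del0 S0 HL L0 dLle inf0.
set k := C / del.
(* Integrating factor: [k * r^del] is a primitive of [C * r^(del - 1)]. *)
pose E r := expR (- k * r `^ del).
have HE (r : R) : 0 < r -> is_derive r 1 E (E r * (- k * (del * r `^ (del - 1)))).
  move=> r0; rewrite /E.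
  have H1 := is_derive1_powR del r0.
  have H2 := @is_deriveZ R R R (fun s => s `^ del) (- k) r 1 _ H1.
  exact: (is_derive1_comp (is_derive_expR _) H2).
pose M r := L r * E r.
have HM (r : R) : 0 < r -> is_derive r 1 M (E r * (dL r - C * r `^ (del - 1) * L r)).
  move=> r0; have H := @is_deriveM R R L E r 1 _ _ (HL r r0) (HE r r0).
  apply: (is_derive_eq H); rewrite /GRing.scale/= /k.
  by field; rewrite gt_eqF.
have Mle (x : R) : 0 < x -> x < S -> M S <= M x.
  move=> x0 xS.
  have [c /andP[xc cS] Hc] := MVT_pos HM _ _ x0 xS.
  rewrite -subr_le0 Hc mulr_le0_ge0 ?subr_ge0 ?(ltW xS)//.
  rewrite mulr_ge0_le0 ?expR_ge0// subr_le0 dLle ?(ltW cS)//.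
  exact: lt_trans xc.
apply/eqP; rewrite eq_le L0 andbT leNgt; apply/negP => LS.
have MS : 0 < M S by rewrite mulr_gt0// expR_gt0.
pose B := expR (`|k| * S `^ del).
have B0 : 0 < B by rewrite expR_gt0.
have [x /andP[x0 xS] Lx] := inf0 (M S / (2 * B)) S
  (divr_gt0 MS (mulr_gt0 (ltr0Sn _ 1) B0)) S0.
have Ex : E x <= B.
  rewrite ler_expR; apply: (@le_trans _ _ (`|k| * x `^ del)).
    by rewrite ler_wpM2r ?powR_ge0// -normrN ler_norm.
  by rewrite ler_wpM2l// ge0_ler_powR ?nnegrE ?(ltW del0) ?(ltW x0) ?(ltW S0) ?(ltW xS).
have : M x <= M S / (2 * B) * B by rewrite ler_pM// expR_ge0.
have -> : M S / (2 * B) * B = M S / 2 by field; rewrite gt_eqF.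
have := Mle x x0 xS; lra.
Qed.

(** The term [Y], which dominates [b G^2 / t], absorbs the other two terms of the
    quadratic form at the price of a multiple of [Z^2 + G^2] that is
    proportional to [t]. *)
Lemma quadratic_absorption {R : realFieldType} (p q b t Z G Y : R) :
  0 < b -> 0 < t -> b * G ^+ 2 / t <= Y ->
  2 * (p * Z * G + q * G ^+ 2 - Y) <=
  (p ^+ 2 + q ^+ 2) / b * t * (Z ^+ 2 + G ^+ 2).
Proof.
move=> b0 t0 HY; rewrite -subr_ge0.
(* Of the amount [2 b G^2 / t] supplied by [2 Y], one half completes the square
   with [p Z G] and the other half the square with [q G^2]. *)
pose sq := ((p * t * Z - b * G) ^+ 2 + p ^+ 2 * t ^+ 2 * G ^+ 2) +
  ((q * t - b) ^+ 2 * G ^+ 2 + q ^+ 2 * t ^+ 2 * Z ^+ 2).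
have sq_ge0 : 0 <= sq / (b * t).
  apply: divr_ge0; last by rewrite mulr_ge0// ltW.
  by do ![exact: sqr_ge0 | apply: addr_ge0 | apply: mulr_ge0].
have sqE : sq / (b * t) = (p ^+ 2 + q ^+ 2) / b * t * (Z ^+ 2 + G ^+ 2) -
    2 * (p * Z * G + q * G ^+ 2) + 2 * (b * G ^+ 2 / t).
  by rewrite /sq; field; rewrite !gt_eqF.
by move: sq_ge0; rewrite sqE; lra.
Qed.

(** [f] stands for a difference of the values of [phi m] at two profiles and [d]
    for the difference of the profiles; [N] is the dimension.  The
    inequality on (0, S] encodes the monotonicity of [phi m], and the last
    hypothesis the equality of the limits at 0. *)
Lemma singular_ode_uniqueness (R : realType) (N gam del beta B S : R)
    (f f1 f2 d d1 : R -> R) :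
  0 < del -> 0 < beta -> 0 < B -> 0 < S ->
  (forall r : R, 0 < r -> is_derive r 1 f (f1 r)) ->
  (forall r : R, 0 < r -> is_derive r 1 f1 (f2 r)) ->
  (forall r : R, 0 < r -> is_derive r 1 d (d1 r)) ->
  (forall r : R, 0 < r ->
     f2 r + (N - 1) / r * f1 r + beta * gam * d r + beta * r * d1 r = 0) ->
  (forall r : R, 0 < r -> r <= S ->
     B * (r `^ (gam - 2) * f r) ^+ 2 <=
     r `^ del * (r `^ (gam - 2) * f r * (r `^ gam * d r))) ->
  (forall e : R, 0 < e -> \forall r \near 0^'+, `|r `^ gam * d r| < e) ->
  f S = 0.
Proof.
move=> del0 beta0 B0 S0 Hf Hf1 Hd ode Hmon Hlim.
pose c1 := (N - gam) * (gam - 2).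
pose c2 := 2 * gam - 2 - N.
pose g r := r `^ (gam - 2) * f r.
pose z r := r `^ (gam - 1) * f1 r + beta * (r `^ gam * d r) + (N - gam) * g r.
pose dg r := (z r + c2 * g r - beta * (r `^ gam * d r)) / r.
have Hg (r : R) : 0 < r -> is_derive r 1 g (dg r).
  move=> r0; apply: (is_derive_eq (is_derive_powRM (gam - 2) r0 (Hf r r0))).
  rewrite /dg /z /g /c2 powRB1// powRB2//; field; exact: lt0r_neq0.
(* The equation eliminates [f2] and [d1] together; only [g] is left. *)
have Hz (r : R) : 0 < r -> is_derive r 1 z (c1 * g r / r).
  move=> r0.
  have D1 := is_derive_powRM (gam - 1) r0 (Hf1 r r0).
  have D2 := @is_deriveZ R R R _ beta r 1 _ (is_derive_powRM gam r0 (Hd r r0)).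
  have D3 := @is_deriveZ R R R _ (N - gam) r 1 _ (Hg r r0).
  apply: (is_derive_eq (is_deriveD (is_deriveD D1 D2) D3)).
  have -> : f2 r = - ((N - 1) / r * f1 r + beta * gam * d r + beta * r * d1 r).
    by apply/eqP; rewrite -addr_eq0 !addrA ode.
  rewrite /dg /z /g /c1 /c2 /GRing.scale/= powRB1// powRB2//; field; exact: lt0r_neq0.
pose L r := z r ^+ 2 + g r ^+ 2.
pose dL r := 2 * (z r * (c1 * g r / r) + g r * dg r).
have HL (r : R) : 0 < r -> is_derive r 1 L (dL r).
  move=> r0.
  have D1 := is_deriveX 2 (Hz r r0); have D2 := is_deriveX 2 (Hg r r0).
  apply: (is_derive_eq (is_deriveD D1 D2)).
  by rewrite /dL /GRing.scale/=; ring.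
pose C := ((c1 + 1) ^+ 2 + c2 ^+ 2) / (beta * B).
have LS : L S = 0.
  apply: (@singular_gronwall R L dL C del S) => //.
  - by move=> r; rewrite addr_ge0// sqr_ge0.
  - move=> r r0 rS; have := Hmon r r0 rS.
    rewrite /dL /dg /L /C powRB1// -/(g r).
    have t0 : 0 < r `^ del by rewrite powR_gt0.
    move: (r `^ del) t0 (g r) (z r) (r `^ gam * d r) => t t0 G Z X.
    move=> HGX.
    have -> : 2 * (Z * (c1 * G / r) + G * ((Z + c2 * G - beta * X) / r)) =
      (2 * ((c1 + 1) * Z * G + c2 * G ^+ 2 - beta * (G * X))) / r.
      by field; exact: lt0r_neq0.
    have -> : ((c1 + 1) ^+ 2 + c2 ^+ 2) / (beta * B) * (t / r) * (Z ^+ 2 + G ^+ 2) =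
      (((c1 + 1) ^+ 2 + c2 ^+ 2) / (beta * B) * t * (Z ^+ 2 + G ^+ 2)) / r.
      by field; rewrite !gt_eqF.
    rewrite ler_pM2r ?invr_gt0//; apply: quadratic_absorption => //; first exact: mulr_gt0.
    rewrite ler_pdivrMr// -!mulrA ler_pM2l//.
    by have -> : G * (X * t) = t * (G * X); [ring | ].
  - move=> e rho e0 rho0.
    pose K := (4 + `|c2| + beta) ^+ 2 + 1.
    have K0 : 0 < K by rewrite ltr_wpDl ?sqr_ge0.
    pose e' := Num.sqrt (e / K).
    have e'0 : 0 < e' by rewrite sqrtr_gt0 divr_gt0.
    have Sd0 : 0 < S `^ del by rewrite powR_gt0.
    (* The second bound on [r^gam d] makes [g] smaller than [e'], through
       [B |g| <= r^del |r^gam d|]. *)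
    have [rho2 rho20 Hrho2] : exists2 rho2, 0 < rho2 &
        forall r : R, 0 < r -> r < rho2 ->
          `|r `^ gam * d r| < Num.min e' (e' * B / S `^ del).
      by apply/near_right0P/Hlim; rewrite lt_min e'0 !mulr_gt0// invr_gt0.
    pose rho1 := Num.min S rho2.
    have rho10 : 0 < rho1 by rewrite lt_min S0.
    have Hrho1 (r : R) : 0 < r -> r < rho1 -> `|g r| < e' /\ `|r `^ gam * d r| < e'.
      move=> r0; rewrite lt_min => /andP[rS rrho].
      have := Hrho2 r r0 rrho; rewrite lt_min => /andP[X1 X2]; split => //.
      have [->|g0] := eqVneq (g r) 0; first by rewrite normr0.
      have := Hmon r r0 (ltW rS); rewrite -/(g r) -real_normK ?num_real//.
      move: X2; rewrite ltr_pdivlMr// => X2 HM.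
      have gr0 : 0 < `|g r| by rewrite normr_gt0.
      have rSd : r `^ del <= S `^ del.
        by rewrite ge0_ler_powR ?nnegrE ?(ltW del0) ?(ltW r0) ?(ltW S0) ?(ltW rS).
      rewrite -(ltr_pM2r B0); apply: le_lt_trans X2.
      rewrite -(ler_pM2r gr0).
      have -> : `|g r| * B * `|g r| = B * `|g r| ^+ 2 by ring.
      apply: (le_trans HM).
      have -> : `|r `^ gam * d r| * S `^ del * `|g r| =
        S `^ del * `|g r * (r `^ gam * d r)| by rewrite [in RHS]normrM; ring.
      by rewrite (le_trans (ler_wpM2l (powR_ge0 _ _) (ler_norm _)))// ler_wpM2r.
    (* Between [x] and [2x] the mean value theorem gives a point where [r g'] is bounded by
       the oscillation of [g]; there [z] is recovered from the equation for [g]. *)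
    pose x := Num.min rho rho1 / 3.
    have x0 : 0 < x by rewrite divr_gt0// lt_min rho0.
    have x1 : 3 * x <= rho by rewrite mulrC divfK// ge_min lexx.
    have x2 : 3 * x <= rho1 by rewrite mulrC divfK// ge_min lexx orbT.
    have x2x : x < 2 * x by lra.
    have [c /andP[xc c2x] Hc] := MVT_pos Hg _ _ x0 x2x.
    have c0 : 0 < c by exact: lt_trans xc.
    exists c; first by apply/andP; split; lra.
    have [G1 _] := Hrho1 x ltac:(lra) ltac:(lra).
    have [G2 _] := Hrho1 (2 * x) ltac:(lra) ltac:(lra).
    have [G3 X3] := Hrho1 c ltac:(lra) ltac:(lra).
    have Hcg : `|c * dg c| <= 4 * e'.
      have xdg : x * dg c = g (2 * x) - g x by rewrite Hc; ring.
      rewrite normrM gtr0_norm//; apply: (@le_trans _ _ (2 * (x * `|dg c|))).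
        by rewrite mulrA ler_wpM2r// ltW.
      rewrite -{1}(gtr0_norm x0) -normrM xdg.
      have := ler_normB (g (2 * x)) (g x); lra.
    have zE : z c = c * dg c - c2 * g c + beta * (c `^ gam * d c).
      by rewrite /dg; field; exact: lt0r_neq0.
    have Hzc : `|z c| <= (4 + `|c2| + beta) * e'.
      rewrite zE; apply: le_trans (ler_normD _ _) _.
      have -> : (4 + `|c2| + beta) * e' = 4 * e' + `|c2| * e' + beta * e' by ring.
      rewrite lerD//.
        apply: le_trans (ler_normB _ _) _; rewrite lerD// normrM.
        by rewrite ler_wpM2l// ltW.
      by rewrite normrM gtr0_norm// ler_wpM2l// ltW.
    have -> : e = K * e' ^+ 2.
      rewrite sqr_sqrtr ?divr_ge0 ?ltW//; field; exact: lt0r_neq0.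
    rewrite /L /K mulrDl mul1r -exprMn lerD//.
      rewrite -real_normK ?num_real// lerXn2r ?nnegrE//.
      by rewrite mulr_ge0 ?(ltW e'0)// !addr_ge0// ltW.
    by rewrite -real_normK ?num_real// lerXn2r ?nnegrE ?(ltW e'0)// ltW.
move/eqP: LS; rewrite /L paddr_eq0 ?sqr_ge0// => /andP[_].
by rewrite sqrf_eq0 mulf_eq0 gt_eqF ?powR_gt0// => /eqP.
Qed.

(** * Radial functions *)

(** The derivative along [e] is the derivative of the restriction to a line of
    direction [e]; [is_derive_of_line] is the converse at the base point. *)
Lemma is_derive_line {R : realType} {V W : normedModType R} (F : V -> W)
    (x e : V) (t : R) :
  derivable F (t *: e + x) e ->
  is_derive t 1 (fun s : R => F (s *: e + x)) ('D_e F (t *: e + x)).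
Proof.
have E : (fun h : R => h^-1 *: (F ((h *: 1 + t) *: e + x) - F (t *: e + x))) =
    (fun h : R => h^-1 *: (F (h *: e + (t *: e + x)) - F (t *: e + x))).
  by apply/funext => h; rewrite [h *: 1]mulr1 scalerDl addrA.
move=> dF; apply: DeriveDef.
- by rewrite /derivable E.
- by rewrite /derive E.
Qed.

Lemma is_derive_of_line {R : realType} {V W : normedModType R} (F : V -> W)
    (x e : V) (D : W) :
  is_derive (0 : R) 1 (fun s : R => F (s *: e + x)) D -> is_derive x e F D.
Proof.
move=> [dF <-].
have E : (fun h : R => h^-1 *: (F ((h *: (1 : R) + (0 : R) : R) *: e + x) - F ((0 : R) *: e + x))) =
    (fun h : R => h^-1 *: (F (h *: e + x) - F x)).
  by apply/funext => h; rewrite [h *: 1]mulr1 addr0 scale0r add0r.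
apply: DeriveDef; first exact/derivable1P.
by rewrite /derive E.
Qed.

Lemma enorm_sum_gt0 {R : realType} {n : nat} (x : 'rV[R]_n) :
  x != 0 -> 0 < \sum_(i < n) x ord0 i ^+ 2.
Proof.
move=> x0; rewrite lt_def sumr_ge0 ?andbT; last by move=> *; exact: sqr_ge0.
apply: contra x0; rewrite psumr_eq0; last by move=> *; exact: sqr_ge0.
move=> /allP H; apply/eqP/rowP => i; rewrite mxE.
by have := H i (mem_index_enum _); rewrite sqrf_eq0 => /eqP.
Qed.

Lemma enorm_gt0 {R : realType} {n : nat} (x : 'rV[R]_n) : x != 0 -> 0 < enorm x.
Proof. by move=> x0; rewrite sqrtr_gt0 enorm_sum_gt0. Qed.

Lemma sqr_enorm {R : realType} {n : nat} (x : 'rV[R]_n) :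
  enorm x ^+ 2 = \sum_(i < n) x ord0 i ^+ 2.
Proof. by rewrite sqr_sqrtr// sumr_ge0// => *; exact: sqr_ge0. Qed.

Lemma near_neq0 {R : realType} {n : nat} (x : 'rV[R]_n) :
  x != 0 -> \forall y \near x, y != 0.
Proof. exact: (@cvgr_neq0 R 'rV[R]_n _ (nbhs x) _ id x cvg_id). Qed.

Lemma is_derive_enorm {R : realType} {n : nat} (x : 'rV[R]_n) (j : 'I_n) :
  x != 0 -> is_derive x (delta_mx ord0 j : 'rV[R]_n) (@enorm R n) (x ord0 j / enorm x).
Proof.
move=> x0; apply: is_derive_of_line.
have N0 := enorm_sum_gt0 _ x0.
pose q (s : R) := \sum_(i < n) x ord0 i ^+ 2 + (2 * x ord0 j) * s + s ^+ 2.
have -> : (fun s : R => enorm (s *: delta_mx ord0 j + x)) = Num.sqrt \o q.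
  apply/funext => s /=; congr Num.sqrt; rewrite /q.
  rewrite (bigD1 j)//= [in RHS](bigD1 j)//= !mxE !eqxx/= mulr1.
  rewrite (eq_bigr (fun i => x ord0 i ^+ 2)); first by ring.
  by move=> i ij; rewrite !mxE (negbTE ij) andbF mulr0 add0r.
have Hq : is_derive (0 : R) 1 q (2 * x ord0 j).
  have D1 := is_deriveD (is_derive_cst (\sum_(i < n) x ord0 i ^+ 2 : R) (0 : R) (1 : R))
    (is_deriveZ (2 * x ord0 j) (is_derive_id (0 : R) (1 : R))).
  have D2 := is_deriveD D1 (is_deriveX 2 (is_derive_id (0 : R) (1 : R))).
  by apply: (is_derive_eq D2); rewrite /GRing.scale/=; ring.
have q0 : q 0 = \sum_(i < n) x ord0 i ^+ 2 by rewrite /q; ring.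
have Hs : is_derive (q 0) 1 Num.sqrt (2 * Num.sqrt (q 0))^-1.
  by apply: is_derive1_sqrt; rewrite q0.
apply: (is_derive_eq (is_derive1_comp Hs Hq)).
rewrite q0 -/(enorm x); field.
by rewrite gt_eqF// enorm_gt0.
Qed.

(** Chain rule for [h o enorm]; [h] need only be differentiable at [enorm x]. *)
Lemma is_derive_radial {R : realType} {n : nat} {h : R -> R} {dh : R}
    (x : 'rV[R]_n) (j : 'I_n) :
  x != 0 -> is_derive (enorm x) 1 h dh ->
  is_derive x (delta_mx ord0 j : 'rV[R]_n) (fun y => h (enorm y))
    (dh * (x ord0 j / enorm x)).
Proof.
move=> x0 Hh; apply: is_derive_of_line.
have [dN vN] := is_derive_enorm x j x0.
have HN := is_derive_line (@enorm R n) x (delta_mx ord0 j) 0.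
rewrite scale0r add0r in HN.
have {}HN := HN dN; rewrite vN in HN.
apply: (is_derive1_comp _ HN).
by rewrite scale0r add0r.
Qed.

Lemma radial_partial {R : realType} {n : nat} {F : 'rV[R]_n -> R} {h dh : R -> R} :
  (forall x, x != 0 -> F x = h (enorm x)) ->
  (forall r : R, 0 < r -> is_derive r 1 h (dh r)) ->
  forall (j : 'I_n) (x : 'rV[R]_n), x != 0 ->
  partial j F x = dh (enorm x) / enorm x * x ord0 j.
Proof.
move=> FE Hh j x x0; rewrite /partial.
rewrite (near_eq_derive (g := fun y => h (enorm y))).
  have H := is_derive_radial x j x0 (Hh _ (enorm_gt0 _ x0)).
  by rewrite derive_val mulrAC mulrA.
by near do apply: FE; exact: near_neq0.
Unshelve. all: by end_near. Qed.

Lemma radial_xdotgrad {R : realType} {n : nat} {F : 'rV[R]_n -> R} {h dh : R -> R} :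
  (forall x, x != 0 -> F x = h (enorm x)) ->
  (forall r : R, 0 < r -> is_derive r 1 h (dh r)) ->
  forall x : 'rV[R]_n, x != 0 -> xdotgrad F x = enorm x * dh (enorm x).
Proof.
move=> FE Hh x x0; rewrite /xdotgrad.
under eq_bigr do rewrite (radial_partial FE Hh)// mulrCA -expr2.
rewrite -mulr_sumr -sqr_enorm; field; exact/lt0r_neq0/enorm_gt0.
Qed.

Lemma radial_laplacian {R : realType} {n : nat} {F : 'rV[R]_n -> R}
    {h dh ddh : R -> R} :
  (forall x, x != 0 -> F x = h (enorm x)) ->
  (forall r : R, 0 < r -> is_derive r 1 h (dh r)) ->
  (forall r : R, 0 < r -> is_derive r 1 dh (ddh r)) ->
  forall x : 'rV[R]_n, x != 0 ->
  laplacian F x = ddh (enorm x) + (n%:R - 1) / enorm x * dh (enorm x).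
Proof.
move=> FE Hh Hdh x x0; rewrite /laplacian.
pose k r := r `^ (-1) * dh r.
pose dk r := r `^ (-1) * ddh r + (-1) * r `^ (-1) / r * dh r.
have Hk (r : R) : 0 < r -> is_derive r 1 k (dk r).
  by move=> r0; exact: (is_derive_powRM (-1) r0 (Hdh r r0)).
have N0 := enorm_gt0 _ x0.
(* Near [x] the first partial derivative is [k (enorm y) * y_j] with
   [k r = dh r / r], again a radial function up to a coordinate factor. *)
have Hj (j : 'I_n) : partial j (partial j F) x =
    dk (enorm x) / enorm x * x ord0 j ^+ 2 + k (enorm x).
  rewrite /partial (near_eq_derive (g := (fun y => k (enorm y)) * (fun y => y ord0 j))).
    have H1 := is_derive_radial x j x0 (Hk _ N0).
    have H2 : is_derive x (delta_mx ord0 j : 'rV[R]_n) (fun y => y ord0 j : R) 1.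
      apply: is_derive_of_line.
      have -> : (fun s : R => (s *: delta_mx ord0 j + x) ord0 j) = id + cst (x ord0 j).
        by apply/funext => s; rewrite !mxE !eqxx/= mulr1.
      apply: (is_derive_eq (is_deriveD (is_derive_id _ _) (is_derive_cst _ _ _))).
      by rewrite addr0.
    rewrite (@derive_val _ _ _ _ _ _ _ (is_deriveM H1 H2)) /GRing.scale/=; ring.
  near=> y; rewrite -/(partial j F y) (radial_partial FE Hh); last first.
    by near: y; exact: near_neq0.
  have y0 : 0 < enorm y by apply: enorm_gt0; near: y; exact: near_neq0.
  change (dh (enorm y) / enorm y * y ord0 j = k (enorm y) * y ord0 j).
  by rewrite /k powR_inv1 ?(ltW y0)// [_^-1 * _]mulrC.
under eq_bigr do rewrite Hj.
rewrite big_split/= -mulr_sumr -sqr_enorm sumr_const card_ord -mulr_natr.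
rewrite /dk /k powR_inv1 ?ltW//; field; exact: lt0r_neq0.
Unshelve. all: by end_near. Qed.

(** * The nonlinearity phi *)

Lemma is_derive_phi {R : realType} (m : R) {u : R} :
  0 < u -> is_derive u 1 (phi m) (u `^ (m - 1)).
Proof.
move=> u0; have [->|m0] := eqVneq m 0.
  have -> : @phi R 0 = @ln R by apply/funext => x; rewrite /phi eqxx.
  by rewrite sub0r powR_inv1 ?ltW//; exact: is_derive1_ln.
have -> : phi m = m^-1 \*: (fun x : R => x `^ m).
  by apply/funext => x; rewrite /phi (negbTE m0) mulrC.
apply: (is_derive_eq (is_deriveZ m^-1 (is_derive1_powR m u0))).
by rewrite /GRing.scale/= mulKf.
Qed.

(** Monotonicity and Lipschitz continuity of [phi m] above [a] in one
    inequality: the derivative [c^(m-1)] lies in (0, a^(m-1)] because [m < 1]. *)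
Lemma phi_monotone_lipschitz {R : realType} (m a u1 u2 : R) :
  m < 1 -> 0 < a -> a <= u1 -> a <= u2 ->
  a `^ (1 - m) * (phi m u1 - phi m u2) ^+ 2 <=
  (phi m u1 - phi m u2) * (u1 - u2).
Proof.
move=> m1 a0; wlog u21 : u1 u2 / u2 < u1.
  move=> H au1 au2; have [u21|u12|->] := ltgtP u2 u1; first exact: H.
    rewrite -sqrrN opprB -[leRHS]mulrNN !opprB; exact: H.
  by rewrite !subrr expr0n/= mul0r mulr0.
move=> au1 au2.
have [c /andP[u2c _] ->] := MVT_pos (fun x x0 => is_derive_phi m x0) u2 u1
  (lt_le_trans a0 au2) u21.
have ac : a <= c by rewrite (le_trans au2)// ltW.
have c0 : 0 < c by exact: lt_le_trans ac.
have p0 : 0 < c `^ (1 - m) by exact: powR_gt0.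
have -> : c `^ (m - 1) = (c `^ (1 - m))^-1 by rewrite -powRN opprB.
have pa : a `^ (1 - m) <= c `^ (1 - m).
  by rewrite ge0_ler_powR ?nnegrE ?(ltW a0) ?(ltW c0)// subr_ge0 ltW.
set d := u1 - u2; set p := c `^ (1 - m) in p0 pa *.
have -> : a `^ (1 - m) * (p^-1 * d) ^+ 2 = (a `^ (1 - m) / p) * (p^-1 * d * d).
  by field; exact: lt0r_neq0.
rewrite -[leRHS]mul1r ler_wpM2r//; last by rewrite ler_pdivrMr// mul1r.
by rewrite -mulrA -expr2 mulr_ge0 ?sqr_ge0// invr_ge0 ltW.
Qed.

Lemma phi_inj {R : realType} (m u1 u2 : R) :
  0 < u1 -> 0 < u2 -> phi m u1 = phi m u2 -> u1 = u2.
Proof.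
wlog u21 : u1 u2 / u2 < u1.
  move=> H u10 u20 E; have [u21|u12|//] := ltgtP u2 u1; first exact: H.
  by apply/esym; exact: H.
move=> _ u20 E.
have [c /andP[u2c _] /esym/eqP] := MVT_pos (fun x x0 => is_derive_phi m x0) u2 u1 u20 u21.
rewrite E subrr mulf_eq0 gt_eqF ?powR_gt0//; last exact: lt_trans u2c.
by rewrite subr_eq0 => /eqP.
Qed.

(** * From the elliptic equation to the profile *)

Lemma enorm_axis {R : realType} {n : nat} (i : 'I_n) (r : R) :
  0 < r -> enorm (r *: delta_mx ord0 i : 'rV[R]_n) = r.
Proof.
move=> r0; rewrite /enorm (bigD1 i)//= big1 => [|j ji].
  by rewrite !mxE !eqxx/= mulr1 addr0 sqrtr_sqr gtr0_norm.
by rewrite !mxE (negbTE ji) andbF mulr0 expr0n.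
Qed.

Lemma axis_neq0 {R : realType} {n : nat} (i : 'I_n) (r : R) :
  0 < r -> (r *: delta_mx ord0 i : 'rV[R]_n) != 0.
Proof.
move=> r0; apply/eqP => /rowP/(_ i); rewrite !mxE !eqxx/= mulr1 => /eqP.
by rewrite gt_eqF.
Qed.

(** The profile is the restriction of the solution to the half-line spanned by the
    [i]-th basis vector, from which it inherits its regularity; [h'] and [h''] are
    the first two derivatives of [phi m o w]. *)
Lemma radial_ode {R : realType} {n : nat} (m alpha beta : R)
    (v : 'rV[R]_n -> R) (w : R -> R) (i : 'I_n) :
  elliptic_solution m alpha beta v -> radial_profile v w ->
  (forall r : R, 0 < r -> 0 < w r) /\
  exists w' h' h'' : R -> R, forall r : R, 0 < r ->
  [/\ is_derive r 1 w (w' r), is_derive r 1 (fun s => phi m (w s)) (h' r),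
      is_derive r 1 h' (h'' r) &
      h'' r + (n%:R - 1) / r * h' r + alpha * w r + beta * r * w' r = 0].
Proof.
move=> [[_ vC1] vpos vE] vw.
pose e : 'rV[R]_n := delta_mx ord0 i.
have wE (r : R) : 0 < r -> w r = v (r *: e + 0).
  by move=> r0; rewrite addr0 vw ?axis_neq0// enorm_axis.
pose w' r := partial i v (r *: e + 0).
pose w'' r := partial i (partial i v) (r *: e + 0).
have Hw (r : R) : 0 < r -> is_derive r 1 w (w' r).
  move=> r0.
  apply: (near_eq_is_derive (f := fun s : R => v (s *: e + 0))).
    by near=> s; rewrite wE//; near: s; exact: lt_nbhsr.
  apply: is_derive_line; apply: (proj1 (vC1 i)).
  by rewrite /punctured/= addr0 axis_neq0.
have Hw' (r : R) : 0 < r -> is_derive r 1 w' (w'' r).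
  move=> r0; apply: is_derive_line; apply: (proj1 (proj2 (proj2 (vC1 i)) i)).
  by rewrite /punctured/= addr0 axis_neq0.
have wpos (r : R) : 0 < r -> 0 < w r.
  by move=> r0; rewrite wE// addr0 vpos// axis_neq0.
pose h' r := w r `^ (m - 1) * w' r.
have Hh (r : R) : 0 < r -> is_derive r 1 (phi m \o w) (h' r).
  by move=> r0; exact: (is_derive1_comp (is_derive_phi m (wpos r r0)) (Hw r r0)).
pose h'' r := w r `^ (m - 1) * w'' r +
   w' r * ((m - 1) * w r `^ (m - 1 - 1) * w' r).
have Hh' (r : R) : 0 < r -> is_derive r 1 h' (h'' r).
  move=> r0.
  have H1 := is_derive1_comp (is_derive1_powR (m - 1) (wpos r r0)) (Hw r r0).
  exact: (is_deriveM H1 (Hw' r r0)).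
split=> //; exists w', h', h'' => r r0; split; [exact: Hw|exact: Hh|exact: Hh'|].
have x0 := axis_neq0 (n := n) i r r0.
have := vE _ x0.
have FE (x : 'rV[R]_n) : x != 0 -> phi m (v x) = (phi m \o w) (enorm x).
  by move=> xn0; rewrite /= vw.
rewrite (radial_laplacian FE Hh Hh' _ x0) (radial_xdotgrad vw Hw _ x0).
by rewrite vw// !enorm_axis// mulrA.
Unshelve. all: by end_near. Qed.

Lemma radial_limit {R : realType} {n : nat} (gam A : R)
    (v : 'rV[R]_n -> R) (w : R -> R) (i : 'I_n) :
  radial_profile v w ->
  enorm x `^ gam * v x @[x --> (0 : 'rV[R]_n)^'] --> A ->
  r `^ gam * w r @[r --> 0^'+] --> A.
Proof.
move=> vw Hv.
have Hax : (r : R) *: (delta_mx ord0 i : 'rV[R]_n) @[r --> 0^'+] --> (0 : 'rV[R]_n)^'.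
  have H0 : (r : R) *: (delta_mx ord0 i : 'rV[R]_n) @[r --> 0^'+] --> (0 : 'rV[R]_n).
    rewrite -[X in _ --> X](scale0r (delta_mx ord0 i : 'rV[R]_n)).
    by apply: cvgZr_tmp; apply: cvg_at_right_filter; exact: cvg_id.
  move=> P P0; have := H0 _ P0; rewrite /nbhs/=.
  apply: filterS2 (nbhs_right_gt 0) => r r0; apply.
  exact: axis_neq0.
have H := cvg_comp _ _ Hax Hv.
apply: cvg_trans H; apply: near_eq_cvg; near=> r.
have r0 : 0 < r by near: r; exact: nbhs_right_gt.
by rewrite /= vw ?axis_neq0// enorm_axis.
Unshelve. all: by end_near. Qed.

(** [r^gam w] is bounded below by half its limit near 0 and by compactness on the rest
    of (0, S]. *)
Lemma profile_lower_bound {R : realType} (gam A S : R) (w w' : R -> R) :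
  0 < A -> 0 < S -> (forall r : R, 0 < r -> 0 < w r) ->
  (forall r : R, 0 < r -> is_derive r 1 w (w' r)) ->
  r `^ gam * w r @[r --> 0^'+] --> A ->
  exists2 a : R, 0 < a & forall r : R, 0 < r -> r <= S -> a <= r `^ gam * w r.
Proof.
move=> A0 S0 wpos Hw Hlim.
pose u r := r `^ gam * w r.
have [e e0 He] : exists2 e : R, 0 < e & forall r : R, 0 < r -> r < e -> A / 2 < u r.
  apply: near_right0P; apply: (cvgr_gt A Hlim); lra.
pose d := Num.min e S / 2.
have d0 : 0 < d by rewrite divr_gt0// lt_min e0.
have de : d < e.
  by rewrite /d ltr_pdivrMr// gt_min mulr_natr mulr2n ltrDl e0.
have dS : d <= S.
  by rewrite /d ler_pdivrMr// ge_min mulr_natr mulr2n lerDl (ltW S0) orbT.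
have Hu (r : R) : 0 < r -> is_derive r 1 u (r `^ gam * w' r + gam * r `^ gam / r * w r).
  by move=> r0; exact: is_derive_powRM (Hw r r0).
have [c cin Hc] := EVT_min dS (is_derive_pos_continuous Hu d S d0).
have c0 : 0 < c by move: cin; rewrite in_itv/= => /andP[dc _]; exact: lt_le_trans dc.
have uc0 : 0 < u c by rewrite mulr_gt0 ?powR_gt0 ?wpos.
exists (Num.min (A / 2) (u c)); first by rewrite lt_min uc0 andbT divr_gt0.
move=> r r0 rS; rewrite ge_min; have [rd|dr] := ltP r d.
  by rewrite ltW// He// (lt_trans rd).
by rewrite Hc ?orbT// in_itv/= dr.
Qed.

Theorem theorem1p3 (R : realType) (n : nat) (m rho1 lambda beta : R)
    (v1 v2 : 'rV[R]_n -> R) (w1 w2 : R -> R) :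
  (3 <= n)%N ->
  0 <= m -> m < (n%:R - 2) / n%:R ->
  0 < rho1 -> 0 < lambda -> beta0 n m rho1 < beta ->
  elliptic_solution m (alpham m beta rho1) beta v1 ->
  elliptic_solution m (alpham m beta rho1) beta v2 ->
  radial_profile v1 w1 -> radial_profile v2 w2 ->
  enorm x `^ (alpham m beta rho1 / beta) * v1 x @[x --> (0 : 'rV[R]_n)^'] -->
    lambda `^ (- (rho1 / ((1 - m) * beta))) ->
  enorm x `^ (alpham m beta rho1 / beta) * v2 x @[x --> (0 : 'rV[R]_n)^'] -->
    lambda `^ (- (rho1 / ((1 - m) * beta))) ->
  forall r : R, 0 < r -> w1 r = w2 r.
Proof.
move=> n3 m0 mn rho0 lam0 bbeta E1 E2 V1 V2 L1 L2 S S0.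
have n3R : (3 : R) <= n%:R by rewrite ler_nat.
have nm : m * n%:R < n%:R - 2 by rewrite -ltr_pdivlMr//; lra.
have m1 : m < 1 by rewrite (lt_le_trans mn)// ler_pdivrMr; lra.
have beta_gt0 : 0 < beta.
  apply: le_lt_trans bbeta; rewrite /beta0 divr_ge0 ?mulr_ge0 ?(ltW rho0)//.
  by rewrite [n%:R * m]mulrC subr_ge0 ltW.
have i : 'I_n by apply: (@Ordinal n 0); exact: leq_trans n3.
set alpha := alpham m beta rho1 in E1 E2 L1 L2 *.
set A := lambda `^ _ in L1 L2.
have A0 : 0 < A by exact: powR_gt0.
pose gam := alpha / beta; pose del := rho1 / beta.
have del0 : 0 < del by exact: divr_gt0.
have alphaE : alpha = beta * gam by rewrite /gam; field; exact: lt0r_neq0.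
have gamE : gam * (1 - m) = 2 + del.
  rewrite /gam /alpha /alpham /del; field.
  by rewrite !lt0r_neq0// subr_gt0.
have [wpos1 [w1' [f1 [f1' ode1]]]] := radial_ode m alpha beta v1 w1 i E1 V1.
have [wpos2 [w2' [f2 [f2' ode2]]]] := radial_ode m alpha beta v2 w2 i E2 V2.
have {}L1 := radial_limit gam A v1 w1 i V1 L1.
have {}L2 := radial_limit gam A v2 w2 i V2 L2.
have [a1 a10 H1] := profile_lower_bound gam A S w1 w1' A0 S0 wpos1
  (fun r r0 => let: And4 P _ _ _ := ode1 r r0 in P) L1.
have [a2 a20 H2] := profile_lower_bound gam A S w2 w2' A0 S0 wpos2
  (fun r r0 => let: And4 P _ _ _ := ode2 r r0 in P) L2.
pose a := Num.min a1 a2.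
have a0 : 0 < a by rewrite lt_min a10.
apply: (phi_inj m); [exact: wpos1|exact: wpos2|].
apply/eqP; rewrite -subr_eq0; apply/eqP.
apply: (@singular_ode_uniqueness R n%:R gam del beta (a `^ (1 - m)) S
  (fun r => phi m (w1 r) - phi m (w2 r)) (fun r => f1 r - f2 r)
  (fun r => f1' r - f2' r) (fun r => w1 r - w2 r) (fun r => w1' r - w2' r)) => //.
- exact: powR_gt0.
- by move=> r r0; have [_ P _ _] := ode1 r r0; have [_ Q _ _] := ode2 r r0; exact: is_deriveB.
- by move=> r r0; have [_ _ P _] := ode1 r r0; have [_ _ Q _] := ode2 r r0; exact: is_deriveB.
- by move=> r r0; have [P _ _ _] := ode1 r r0; have [Q _ _ _] := ode2 r r0; exact: is_deriveB.
- move=> r r0; have [_ _ _ P] := ode1 r r0; have [_ _ _ Q] := ode2 r r0.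
  rewrite -alphaE -[RHS](subrr 0) -{1}P -Q; ring.
(* [phi_monotone_lipschitz] at the level [a r^(-gam)], scaled by powers of [r]; the
   exponents match because [gam (1 - m) = 2 + del]. *)
- move=> r r0 rS.
  set p := r `^ gam; have p0 : 0 < p by exact: powR_gt0.
  have b1 : a / p <= w1 r.
    by rewrite ler_pdivrMr// mulrC (le_trans _ (H1 r r0 rS))// ge_min lexx.
  have b2 : a / p <= w2 r.
    by rewrite ler_pdivrMr// mulrC (le_trans _ (H2 r r0 rS))// ge_min lexx orbT.
  have := phi_monotone_lipschitz m (a / p) (w1 r) (w2 r) m1 (divr_gt0 a0 p0) b1 b2.
  have -> : (a / p) `^ (1 - m) = a `^ (1 - m) / (r `^ del * r ^+ 2).
    rewrite powRM ?invr_ge0 ?ltW// -powR_inv1 ?(ltW p0)// -powRrM -powRrM.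
    have -> : gam * (-1 * (1 - m)) = - (del + 2) by rewrite mulN1r mulrN gamE addrC.
    by rewrite powRN [r `^ (del + 2)]powRD ?(gt_eqF r0) ?implybT// (powR_mulrn 2) ?(ltW r0).
  rewrite powRB2// -/p.
  have t0 : 0 < r `^ del by exact: powR_gt0.
  move: (r `^ del) t0 (a `^ _) (phi m (w1 r) - _) (w1 r - _) => t t0 B F D H.
  have q0 : 0 < p ^+ 2 / r ^+ 2 * t by rewrite mulr_gt0// divr_gt0// exprn_gt0.
  have -> : B * (p / r ^+ 2 * F) ^+ 2 = p ^+ 2 / r ^+ 2 * t * (B / (t * r ^+ 2) * F ^+ 2).
    by field; rewrite !lt0r_neq0.
  have -> : t * (p / r ^+ 2 * F * (p * D)) = p ^+ 2 / r ^+ 2 * t * (F * D).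
    by field; rewrite !lt0r_neq0.
  by rewrite ler_pM2l.
- move=> e e0.
  have HX : r `^ gam * (w1 r - w2 r) @[r --> 0^'+] --> 0.
    rewrite -[X in _ --> X](subrr A).
    have -> : (fun r => r `^ gam * (w1 r - w2 r)) =
      (fun r => r `^ gam * w1 r - r `^ gam * w2 r) by apply/funext => r; rewrite mulrBr.
    exact: (cvgB L1 L2).
  by apply: cvgr0_norm_lt.
Qed.
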